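(* Let $0 < \alpha < \frac{1}{3}$ be a constant, let $p_n = n^{-\alpha}$, and let $G \sim G(n,p_n)$. Then with high probability $G$ is exactly reconstructable from its $1$-neighborhoods. That is, the probability that every graph $H$ on the vertex set $[n]$ with $G \sim_1 H$ satisfies $H = G$ tends to $1$ as $n \to \infty$.
   Context: All graphs are simple and undirected, with labeled vertex set $V = [n] = \{1,\dots,n\}$. $G(n,p_n)$ is the Erdős–Rényi random graph on $[n]$: each pair of distinct vertices is an edge independently with probability $p_n$. ''With high probability'' means with probability tending to $1$ as $n \to \infty$. For a vertex $v$ of a graph $G$, $\mathcal{N}_r(v)$ is the subgraph of $G$ induced by all vertices at graph distance at most $r$ from $v$. For each $v \in V$ one observes $\mathcal{N}_r(v)$ with the central vertex $v$ labeled and all other vertices unlabeled. For two graphs $H_1, H_2$ on $V$, write $H_1 \sim_r H_2$ (they have the same $r$-neighborhoods) if for every $v \in V$ the $r$-neighborhood of $v$ in $H_1$ is isomorphic to the $r$-neighborhood of $v$ in $H_2$ (by an isomorphism fixing the labeled center $v$). $G$ is exactly reconstructable from its $r$-neighborhoods if $G$ itself as a labeled graph (not only up to isomorphism) is determined by this collection, i.e. every graph $H$ on $V$ with $G \sim_r H$ satisfies $H = G$. *)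

(* Defs.v *)
From HB Require Import structures.
From mathcomp Require Import all_boot all_order all_algebra.
From mathcomp Require Import all_classical all_reals all_analysis.

Set Implicit Arguments.
Unset Strict Implicit.
Unset Printing Implicit Defensive.

Import Order.TTheory GRing.Theory Num.Theory.
Import numFieldNormedType.Exports.

Local Open Scope ring_scope.

Definition is_sgraph (T : finType) (e : {ffun T * T -> bool}) : bool :=
  [forall x, ~~ e (x, x)] && [forall x, forall y, e (x, y) == e (y, x)].

Record sgraph (T : finType) := SGraph {
  sgraph_fun : {ffun T * T -> bool};
  sgraph_proof : is_sgraph sgraph_fun }.

HB.instance Definition _ (T : finType) := [isSub for @sgraph_fun T].
HB.instance Definition _ (T : finType) := [Finite of sgraph T by <:].

Definition adj (T : finType) (G : sgraph T) : rel T :=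
  fun x y => sgraph_fun G (x, y).

Lemma adj_irrefl (T : finType) (G : sgraph T) : irreflexive (adj G).
Proof.
by move=> x; case/andP: (sgraph_proof G) => /forallP/(_ x)/negbTE.
Qed.

Lemma adj_sym (T : finType) (G : sgraph T) : symmetric (adj G).
Proof.
move=> x y.
by case/andP: (sgraph_proof G) => _ /forallP/(_ x)/forallP/(_ y)/eqP.
Qed.

(* The graph distance from x to y is at most r: there is a walk from x to y
   with at most r edges (the tuple p lists the vertices after x). *)
Definition dist_le (T : finType) (G : sgraph T) (r : nat) (x y : T) : bool :=
  [exists k : 'I_r.+1, exists p : k.-tuple T,
    path (adj G) x p && (last x p == y)].

Lemma dist_leP (T : finType) (G : sgraph T) (r : nat) (x y : T) :
  reflect (exists p : seq T,
             [/\ path (adj G) x p, last x p = y & (size p <= r)%N])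
          (dist_le G r x y).
Proof.
apply: (iffP existsP) => [[k /existsP[p /andP[pp /eqP lp]]]|[p [pp lp sp]]].
  by exists p; split=> //; rewrite size_tuple -ltnS.
exists (Ordinal (sp : (size p < r.+1)%N)); apply/existsP.
by exists (in_tuple p); rewrite /= pp lp eqxx.
Qed.

Definition ball (T : finType) (G : sgraph T) (r : nat) (v : T) : {set T} :=
  [set u | dist_le G r v u].

Lemma center_in_ball (T : finType) (G : sgraph T) (r : nat) (v : T) :
  v \in ball G r v.
Proof. by rewrite inE; apply/dist_leP; exists [::]. Qed.

Lemma induced_subproof (T : finType) (G : sgraph T) (S : {set T}) :
  is_sgraph [ffun e : {x | x \in S} * {x | x \in S} =>
               adj G (val e.1) (val e.2)].
Proof.
apply/andP; split; apply/forallP => x; first by rewrite ffunE /= adj_irrefl.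
by apply/forallP => y; rewrite !ffunE /= adj_sym.
Qed.

Definition induced (T : finType) (G : sgraph T) (S : {set T}) :
  sgraph {x | x \in S} := SGraph (induced_subproof G S).

(* The r-neighborhood of v as an unlabeled graph with a distinguished center
   is the pair of [nbhd G r v] and [center G r v], considered up to
   [rooted_iso]. *)
Definition nbhd (T : finType) (G : sgraph T) (r : nat) (v : T) :
  sgraph {x | x \in ball G r v} := induced G (ball G r v).

Definition center (T : finType) (G : sgraph T) (r : nat) (v : T) :
  {x | x \in ball G r v} := exist _ v (center_in_ball G r v).

Definition rooted_iso (T1 T2 : finType) (G1 : sgraph T1) (c1 : T1)
    (G2 : sgraph T2) (c2 : T2) : Prop :=
  exists f : T1 -> T2,
    [/\ bijective f, f c1 = c2 &
        forall x y, adj G2 (f x) (f y) = adj G1 x y].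

Definition same_nbhds (T : finType) (r : nat) (H1 H2 : sgraph T) : Prop :=
  forall v : T, rooted_iso (nbhd H1 r v) (center H1 r v)
                           (nbhd H2 r v) (center H2 r v).

Definition exactly_reconstructable (T : finType) (r : nat) (G : sgraph T) :
  Prop := forall H : sgraph T, same_nbhds r G H -> H = G.

(* The probability of the graph G under G(n, p); each unordered pair of
   distinct vertices is represented once, as (i, j) with i < j. *)
Definition gnp_weight (R : realType) (n : nat) (p : R) (G : sgraph 'I_n) : R :=
  \prod_(e : 'I_n * 'I_n | (e.1 < e.2)%N)
    (if adj G e.1 e.2 then p else 1 - p).

Definition gnp_prob (R : realType) (n : nat) (p : R)
    (E : set (sgraph 'I_n)) : R :=
  \sum_(G : sgraph 'I_n | G \in E) gnp_weight p G.

(* Main.v *)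
Require Import Defs.
From mathcomp Require Import all_boot all_order all_algebra.
From mathcomp Require Import all_classical all_reals all_analysis.
From mathcomp Require Import ring lra.

Set Implicit Arguments.
Unset Strict Implicit.
Unset Printing Implicit Defensive.

Import Order.TTheory GRing.Theory Num.Theory.
Import numFieldNormedType.Exports.

Local Open Scope ring_scope.

(** The graph G is recovered from its neighborhoods by comparing pieces of
    neighborhoods.  Let H have the same 1-neighborhoods as G, with isomorphisms
    f_v from the neighborhood of v in G to the one in H, and let v u be an edge
    of H.  Put w = f_v^-1 u, a neighbor of v in G.  If w = u then v u is an edge
    of G.  Otherwise let A be the set of the common neighbors of v and w in G
    that are not adjacent to u.  The map f_v sends A to common neighbors of v
    and u in H, and f_u^-1 sends these to neighbors of u in G.  So A and its
    image are disjoint and span isomorphic subgraphs of G.  This is excluded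
    once two properties hold for some k:
    - no two disjoint k-sets of vertices span isomorphic subgraphs of G
      (the negation of [has_twins]);
    - each set of the form of A, for distinct v, w, u, has at least k elements
      (implied by the negation of [poorly_separated]).
    Then every edge of H is an edge of G, and G = H because the degrees agree
    ([reconstructable_of_separated]).

    Both properties hold with high probability for k the integer part of
    n^(1/3), by union bounds.  A given pair of disjoint k-tuples spans
    corresponding subgraphs with probability at most (1 - p)^(k choose 2) if
    p <= 1/2; this must beat the n^(2k) choices, so k p must be much larger
    than log n ([pr_has_twins]).  If A has fewer than k elements, then at least n - k - 3
    vertices outside of some k-tuple fail, independently, an event of
    probability p^2 (1 - p); this must beat n^(k+3) choices and needs n p^2 much
    larger than k log n ([pr_poorly_separated]).  With p = n^(-alpha) and k near
    n^(1/3), k p is about n^(1/3 - alpha) and n p^2 / k is about its square, so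
    both hold when alpha < 1/3 ([near_union_bounds]). *)

(** * Probabilities and independence of edges *)

Lemma sgraph_eqP (T : finType) (G H : sgraph T) :
  (forall x y, adj G x y = adj H x y) -> G = H.
Proof.
move=> GH; apply: val_inj; apply/ffunP => -[x y]; exact: GH.
Qed.

Lemma symmetrized_subproof (T : finType) (e : rel T) :
  is_sgraph [ffun z : T * T => (z.1 != z.2) && (e z.1 z.2 || e z.2 z.1)].
Proof.
apply/andP; split; apply/forallP => x; first by rewrite ffunE /= eqxx.
by apply/forallP => y; apply/eqP; rewrite !ffunE /= eq_sym orbC.
Qed.

(** Symmetrizing by a disjunction and erasing loops makes this a total
    construction of graphs; below, [e] is either already symmetric or holds
    only for pairs in increasing order. *)
Definition symmetrized (T : finType) (e : rel T) : sgraph T :=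
  SGraph (symmetrized_subproof e).

Lemma adj_symmetrized (T : finType) (e : rel T) x y :
  adj (symmetrized e) x y = (x != y) && (e x y || e y x).
Proof. by rewrite /adj ffunE. Qed.

Definition mix (T : finType) (D : pred {set T}) (G H : sgraph T) : sgraph T :=
  symmetrized (fun x y => if D [set x; y] then adj G x y else adj H x y).

Lemma adj_mix (T : finType) (D : pred {set T}) (G H : sgraph T) x y :
  adj (mix D G H) x y = if D [set x; y] then adj G x y else adj H x y.
Proof.
rewrite adj_symmetrized [[set y; x]]finset.setUC (adj_sym G y) (adj_sym H y).
by case: eqVneq => [->|_] /=; rewrite ?adj_irrefl ?if_same ?orbb.
Qed.

(** Events are localized on sets of unordered pairs, given as two-element sets,
    so that the symmetry of adjacency needs no separate bookkeeping. *)
Definition determined_by (T : finType) (D : pred {set T})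
    (P : pred (sgraph T)) :=
  forall G H, (forall x y, D [set x; y] -> adj G x y = adj H x y) -> P G = P H.

Definition prG (R : realType) (n : nat) (p : R) (P : pred (sgraph 'I_n)) : R :=
  \sum_(G | P G) gnp_weight p G.

Section Probability.
Variables (R : realType) (n : nat) (p : R).
Implicit Types (P Q : pred (sgraph 'I_n)).

(** Graphs correspond to arbitrary choices of a boolean for each pair in
    increasing order, so the sum over graphs of a product over pairs
    distributes.  The total mass and the law of one edge follow. *)
Lemma sum_prod_pairs (h : 'I_n * 'I_n -> bool -> R) :
  \sum_(G : sgraph 'I_n)
    \prod_(e : 'I_n * 'I_n | (e.1 < e.2)%N) h e (adj G e.1 e.2) =
  \prod_(e : 'I_n * 'I_n | (e.1 < e.2)%N) (h e true + h e false).
Proof.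
under [RHS]eq_bigr do rewrite -big_bool.
rewrite (big_distr_big false) /=.
rewrite (reindex_onto (fun f : {ffun 'I_n * 'I_n -> bool} =>
    symmetrized (fun x y : 'I_n => (x < y)%N && f (x, y)))
  (fun G => [ffun e : 'I_n * 'I_n => (e.1 < e.2)%N && adj G e.1 e.2]))
  /=; last first.
  move=> G _; apply: sgraph_eqP => x y; rewrite adj_symmetrized !ffunE /=.
  rewrite (adj_sym G y) !andbA !andbb -andb_orl -neq_ltn -(inj_eq val_inj) /=.
  by rewrite andbA andbb; case: eqVneq => // /val_inj ->; rewrite adj_irrefl.
apply: eq_big => [f|f _].
  apply/eqP/pfamilyP => [<-|[sf _]].
    by split=> // ; apply/supportP => e /negbTE; rewrite unfold_in ffunE => ->.
  apply/ffunP => -[x y]; rewrite ffunE adj_symmetrized /=.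
  have [xy|nxy] /= := boolP (x < y)%N; last by apply/esym/(supportP sf).
  by rewrite (ltnNge y) (ltnW xy) /= orbF -(inj_eq val_inj) /= ltn_eqF.
apply: eq_bigr => -[x y] /= xy; rewrite adj_symmetrized xy /=.
by rewrite (ltnNge y) (ltnW xy) /= orbF -(inj_eq val_inj) /= ltn_eqF.
Qed.

Lemma pr_predT : prG p (fun _ : sgraph 'I_n => true) = 1.
Proof.
rewrite /prG /gnp_weight (sum_prod_pairs (fun _ b => if b then p else 1 - p)).
by rewrite big1 // => e _; rewrite addrC subrK.
Qed.

Lemma pr_predC P : prG p (fun G => ~~ P G) = 1 - prG p P.
Proof.
by rewrite -pr_predT /prG [X in _ = X - _](bigID P) /= addrAC subrr add0r.
Qed.

Lemma pr_split P Q :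
  prG p P = prG p (fun G => P G && Q G) + prG p (fun G => P G && ~~ Q G).
Proof. by rewrite /prG (bigID Q). Qed.

Lemma pr_ext P Q : P =1 Q -> prG p P = prG p Q.
Proof. by move=> PQ; apply: eq_bigl. Qed.

Lemma pr_adj (x y : 'I_n) : x != y -> prG p (fun G => adj G x y) = p.
Proof.
wlog xy : x y / (x < y)%N => [wl xDy|_].
  have := xDy; rewrite -(inj_eq val_inj) /= neq_ltn => /orP[|] lt; first exact: wl.
  by under pr_ext do rewrite adj_sym; apply: wl; rewrite // eq_sym.
rewrite /prG big_mkcond /=.
transitivity (\sum_(G : sgraph 'I_n) \prod_(e : 'I_n * 'I_n | (e.1 < e.2)%N)
  (fun (e : 'I_n * 'I_n) b => (if b then p else 1 - p) *
     (if e == (x, y) then b%:R else 1)) e (adj G e.1 e.2)).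
  apply: eq_bigr => G _ /=; rewrite big_split /= -/(gnp_weight p G).
  rewrite [X in _ = _ * X](bigD1 (x, y)) //= eqxx big1 ?mulr1.
    by case: adj; rewrite ?mulr1 ?mulr0.
  by move=> e /andP[_ /negbTE->].
rewrite (sum_prod_pairs (fun (e : 'I_n * 'I_n) b => (if b then p else 1 - p) *
     (if e == (x, y) then b%:R else 1))) (bigD1 (x, y)) //= eqxx big1.
  by rewrite !mulr1 mulr0 addr0.
by move=> e /andP[_ /negbTE->]; rewrite !mulr1 addrC subrK.
Qed.

Lemma pr_nadj (x y : 'I_n) : x != y -> prG p (fun G => ~~ adj G x y) = 1 - p.
Proof. by move=> xy; rewrite pr_predC pr_adj. Qed.

Lemma weight_mix (D : pred {set 'I_n}) G H :
  gnp_weight p (mix D G H) * gnp_weight p (mix D H G) =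
  gnp_weight p G * gnp_weight p H.
Proof.
rewrite /gnp_weight -!big_split /=; apply: eq_bigr => -[x y] /= _.
by rewrite !adj_mix; case: (D _) => //; rewrite mulrC.
Qed.

(** Exchanging the edges outside of [D] between two graphs is an involution on
    pairs of graphs that preserves the product weight, and it turns the event
    that P holds of the first graph and Q of the second into the event that
    both hold of the first. *)
Lemma pr_indep (D : pred {set 'I_n}) P Q :
    determined_by D P -> determined_by (predC D) Q ->
  prG p (fun G => P G && Q G) = prG p P * prG p Q.
Proof.
move=> dP dQ.
pose s (z : sgraph 'I_n * sgraph 'I_n) := (mix D z.1 z.2, mix D z.2 z.1).
have sK : involutive s.
  by case=> G H; congr pair; apply: sgraph_eqP => x y; rewrite /= !adj_mix;
    case: ifP => // ->.
rewrite /prG big_distrlr /= pair_big (reindex_inj (inv_inj sK)) /=.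
(* The factor 1 is the total mass of the second graph of the pair. *)
rewrite -[LHS]mulr1 -pr_predT /prG big_distrlr /= pair_big /=.
apply: eq_big => [[G H]|[G H] _] /=; last by rewrite weight_mix.
rewrite andbT; congr andb.
  by apply: dP => x y Dxy; rewrite adj_mix Dxy.
by apply: dQ => x y /negbTE /= Dxy; rewrite adj_mix Dxy.
Qed.

Lemma determined_adj (D : pred {set 'I_n}) (x y : 'I_n) :
  D [set x; y] -> determined_by D (fun G => adj G x y).
Proof. by move=> Dxy G H; apply. Qed.

Lemma determined_negb (D : pred {set 'I_n}) P :
  determined_by D P -> determined_by D (fun G => ~~ P G).
Proof. by move=> dP G H GH; rewrite (dP G H). Qed.

Lemma determined_andb (D : pred {set 'I_n}) P Q :
  determined_by D P -> determined_by D Q ->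
  determined_by D (fun G => P G && Q G).
Proof. by move=> dP dQ G H GH; rewrite (dP G H) // (dQ G H). Qed.

Lemma pr_all_indep (J : eqType) (s : seq J) (D : J -> pred {set 'I_n})
    (P : J -> pred (sgraph 'I_n)) (c : R) :
    uniq s -> {in s, forall j, determined_by (D j) (P j)} ->
    {in s &, forall i j e, D i e -> D j e -> i = j} ->
    {in s, forall j, prG p (P j) = c} ->
  prG p (fun G => all (P^~ G) s) = c ^+ size s.
Proof.
elim: s => [_ _ _ _|j s IH /= /andP[js us] dP disj Pc]; first by rewrite pr_predT.
have sjs : {subset s <= j :: s} by move=> i si; rewrite inE si orbT.
rewrite exprS -IH //; first last.
- by move=> i /sjs; apply: Pc.
- by move=> i l /sjs si /sjs; apply: disj.
- by move=> i /sjs; apply: dP.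
rewrite -(Pc j (mem_head j s)); apply: (@pr_indep (D j)).
  by apply: dP; rewrite mem_head.
move=> G H GH; apply: eq_in_all => i si; apply: (dP i (sjs i si)) => x y Dixy.
apply: GH; apply: contraNN js => /= Djxy.
by rewrite (disj _ _ (mem_head j s) (sjs i si) _ Djxy Dixy).
Qed.

Hypothesis p01 : 0 <= p <= 1.

Lemma weight_ge0 (G : sgraph 'I_n) : 0 <= gnp_weight p G.
Proof.
case/andP: p01 => p0 p1; apply: prodr_ge0 => e _.
by case: ifP => _ //; rewrite subr_ge0.
Qed.

Lemma pr_mono P Q : {subset P <= Q} -> prG p P <= prG p Q.
Proof.
move=> PQ; rewrite /prG [leRHS](bigID P) /=.
rewrite (eq_bigl P) => [|G]; last by apply: andb_idl => /PQ.
by rewrite lerDl sumr_ge0 // => G _; apply: weight_ge0.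
Qed.

Lemma pr_le1 P : prG p P <= 1.
Proof. by rewrite -pr_predT; apply: pr_mono. Qed.

Lemma pr_or P Q : prG p (fun G => P G || Q G) <= prG p P + prG p Q.
Proof.
rewrite (pr_split _ P) lerD // pr_mono // => G; rewrite !unfold_in;
  by case: (P G); rewrite /= ?andbF ?andbT.
Qed.

Lemma pr_exists (I : finType) (P : I -> pred (sgraph 'I_n)) (c : R) :
  (forall i, prG p (P i) <= c) -> prG p (fun G => [exists i, P i G]) <= #|I|%:R * c.
Proof.
move=> Pc; apply: (@le_trans _ _ (\sum_i prG p (P i))); last first.
  by rewrite mulr_natl -sumr_const; apply: ler_sum => i _; apply: Pc.
rewrite /prG; under [leRHS]eq_bigr do rewrite big_mkcond.
rewrite exchange_big big_mkcond /=; apply: ler_sum => G _.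
have ge0 (A : pred I) : 0 <= \sum_(i | A i) if P i G then gnp_weight p G else 0.
  by apply: sumr_ge0 => i _; case: ifP => // _; apply: weight_ge0.
case: existsP => [[i PG]|_]; last exact: ge0.
by rewrite (bigD1 i) //= PG lerDl; apply: ge0.
Qed.

End Probability.

(** * Twins and separation *)

Definition twin_tuples (n k : nat) (x y : {ffun 'I_k -> 'I_n}) (G : sgraph 'I_n) :=
  all (fun e : 'I_k * 'I_k => adj G (x e.1) (x e.2) == adj G (y e.1) (y e.2))
    [seq e : 'I_k * 'I_k <- index_enum _ | (e.1 < e.2)%N].

Definition disjoint_tuples (n k : nat) (x y : {ffun 'I_k -> 'I_n}) :=
  [&& injectiveb x, injectiveb y & [forall i, forall j, x i != y j]].

Definition has_twins (n k : nat) (G : sgraph 'I_n) :=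
  [exists z : {ffun 'I_k -> 'I_n} * {ffun 'I_k -> 'I_n},
     disjoint_tuples z.1 z.2 && twin_tuples z.1 z.2 G].

Definition separating (n : nat) (G : sgraph 'I_n) (u v w z : 'I_n) :=
  [&& adj G z u, adj G z v & ~~ adj G z w].

(** All vertices separating [u] and [v] from [w] lie in the range of [s], apart
    from [u], [v] and [w] themselves.  Quantifying over such an [s] expresses
    that there are few of them by events that are independent for the
    different vertices outside of the range. *)
Definition confined (n k : nat) (u v w : 'I_n) (s : {ffun 'I_k -> 'I_n})
    (G : sgraph 'I_n) :=
  all (fun z => ~~ separating G u v w z)
    [seq z <- enum 'I_n | z \notin [:: u, v, w & codom s]].

Definition poorly_separated (n k : nat) (G : sgraph 'I_n) :=
  [exists a : ('I_n * 'I_n * 'I_n) * {ffun 'I_k -> 'I_n},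
    uniq [:: a.1.1.1; a.1.1.2; a.1.2] &&
    confined a.1.1.1 a.1.1.2 a.1.2 a.2 G].

Lemma set2_ord_inj (k : nat) (e f : 'I_k * 'I_k) :
  (e.1 < e.2)%N -> (f.1 < f.2)%N -> [set e.1; e.2] = [set f.1; f.2] -> e = f.
Proof.
case: e f => [a b] [c d] /= ab cd E.
have : a \in [set c; d] by rewrite -E set21.
have : b \in [set c; d] by rewrite -E set22.
rewrite !inE => /orP[]/eqP be /orP[]/eqP ae; subst; move: ab cd;
  by rewrite ?ltnn // => /ltn_trans h /h; rewrite ltnn.
Qed.

Lemma card_pairs_lt (k : nat) :
  size [seq e : 'I_k * 'I_k <- index_enum _ | (e.1 < e.2)%N] = 'C(k, 2).
Proof.
rewrite -sum1_size big_filter.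
rewrite -(pair_big_dep xpredT (fun i j : 'I_k => (i < j)%N) (fun _ _ => 1%N)) /=.
rewrite -triangular_sum (exchange_big_dep xpredT) //= big_mkord.
apply: eq_bigr => j _; rewrite -(big_ord_widen k (fun _ => 1%N)) 1?ltnW //.
by rewrite sum1_card card_ord.
Qed.

Section Bounds.
Variables (R : realType) (n : nat) (p : R).

Lemma pr_twin_pair (x x' y y' : 'I_n) :
    x != x' -> y != y' -> [set x; x'] != [set y; y'] ->
  prG p (fun G => adj G x x' == adj G y y') = 1 - 2 * p * (1 - p).
Proof.
move=> xx yy xy; rewrite (pr_split _ _ (fun G => adj G x x')).
pose D : pred {set 'I_n} := pred1 [set x; x'].
have dx : determined_by D (fun G => adj G x x') by exact/determined_adj/eqxx.
have dy : determined_by (predC D) (fun G => adj G y y').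
  by apply: determined_adj; rewrite /D /= eq_sym.
rewrite (pr_ext p (_ : _ =1 fun G => adj G x x' && adj G y y')); last first.
  by move=> G; do 2![case: adj].
rewrite [X in _ + X]
  (pr_ext p (_ : _ =1 fun G => ~~ adj G x x' && ~~ adj G y y')); last first.
  by move=> G; do 2![case: adj].
rewrite (pr_indep p dx dy) (pr_indep p (determined_negb dx) (determined_negb dy)).
by rewrite !pr_nadj // !pr_adj //; ring.
Qed.

(** The tuples are injective with disjoint ranges, so the different index pairs
    compare different pairs of edges, and the comparisons are independent. *)
Lemma pr_twin_tuples (k : nat) (x y : {ffun 'I_k -> 'I_n}) :
  disjoint_tuples x y ->
  prG p (twin_tuples x y) = (1 - 2 * p * (1 - p)) ^+ 'C(k, 2).
Proof.
case/and3P=> /injectiveP xi /injectiveP yi /forallP xy.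
have {}xy i j : x i != y j by have /forallP := xy i; apply.
pose D (e : 'I_k * 'I_k) : pred {set 'I_n} :=
  pred2 [set x e.1; x e.2] [set y e.1; y e.2].
have xyE i i' j j' : [set x i; x i'] != [set y j; y j'].
  by apply/eqP => E; have := set21 (x i) (x i'); rewrite E !inE !(negbTE (xy _ _)).
rewrite -card_pairs_lt; apply: (pr_all_indep (D := D)).
- by rewrite filter_uniq ?index_enum_uniq.
- by move=> e _ G H GH; rewrite !GH // /D /= eqxx ?orbT.
- move=> e f; rewrite !mem_filter => /andP[lte _] /andP[ltf _] A.
  have imE (z : 'I_k -> 'I_n) : injective z ->
      [set z e.1; z e.2] = [set z f.1; z f.2] -> e = f.
    move=> zi E; apply: set2_ord_inj => //; apply: (imset_inj zi).
    by rewrite !imsetU1 !imset_set1.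
  move=> /= /orP[]/eqP-> /orP[]/eqP E; [exact: imE E | | | exact: imE E].
    by have := xyE e.1 e.2 f.1 f.2; rewrite E eqxx.
  by have := xyE f.1 f.2 e.1 e.2; rewrite -E eqxx.
move=> e; rewrite mem_filter => /andP[lte _].
have e12 : e.1 != e.2 by rewrite -(inj_eq val_inj) /= ltn_eqF.
by apply: pr_twin_pair; rewrite ?(inj_eq xi) ?(inj_eq yi) ?xyE.
Qed.

Lemma pr_separating (u v w z : 'I_n) :
    uniq [:: u; v; w] -> z \notin [:: u; v; w] ->
  prG p (fun G => separating G u v w z) = p ^+ 2 * (1 - p).
Proof.
rewrite /= !inE !negb_or !andbT => /andP[/andP[uv uw] vw] /and3P[zu zv zw].
have neq (a b : 'I_n) : a != b -> z != a -> [set z; a] != [set z; b].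
  move=> ab za; apply: contraNneq ab => E; have := set22 z a.
  by rewrite E !inE eq_sym (negbTE za).
rewrite /separating (@pr_indep _ _ _ (pred1 [set z; u])); first last.
- by apply: determined_andb; [|apply: determined_negb]; apply: determined_adj;
    rewrite /= eq_sym neq.
- exact/determined_adj/eqxx.
rewrite (@pr_indep _ _ _ (pred1 [set z; v])); first last.
- by apply: determined_negb; apply: determined_adj; rewrite /= eq_sym neq.
- exact/determined_adj/eqxx.
by rewrite pr_nadj // !pr_adj //; ring.
Qed.

Hypothesis p01 : 0 <= p <= 1.

(** The vertices [z] outside of [u], [v], [w] and the range of [s] are at least
    n - k - 3 in number.  Each must fail to separate, which depends only on the
    three pairs joining [z] to [u], [v] and [w]. *)
Lemma pr_confined (k : nat) (u v w : 'I_n) (s : {ffun 'I_k -> 'I_n}) :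
    uniq [:: u; v; w] ->
  prG p (confined u v w s) <= (1 - p ^+ 2 * (1 - p)) ^+ (n - k.+3).
Proof.
move=> uvw; case/andP: (p01) => p0 p1.
pose D (z : 'I_n) : pred {set 'I_n} := pred3 [set z; u] [set z; v] [set z; w].
rewrite (pr_all_indep (D := D) (c := 1 - p ^+ 2 * (1 - p))).
- apply: ler_wiXn2l; first by rewrite subr_ge0; nra.
    by rewrite gerBl; nra.
  rewrite leq_subLR size_filter -[X in (X <= _)%N](size_enum_ord n).
  rewrite -(count_predC (fun z => z \notin [:: u, v, w & codom s])) addnC leq_add2r.
  rewrite -size_filter (_ : k.+3 = size [:: u, v, w & codom s]); last first.
    by rewrite /= size_codom card_ord.
  apply: uniq_leq_size; first by rewrite filter_uniq ?enum_uniq.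
  by move=> z; rewrite mem_filter => /andP[/negbNE].
- by rewrite filter_uniq ?enum_uniq.
- by move=> z _ G H GH; rewrite /separating !GH // /D /= eqxx ?orbT.
- move=> z z'; rewrite !mem_filter => /andP[zn _] /andP[zn' _] e De De'.
  have z'e : z' \in e by case/or3P: De' => /eqP->; rewrite set21.
  move: z'e; case/or3P: De => /eqP->; rewrite !inE => /orP[/eqP-> //|/eqP z'E];
  by move: zn'; rewrite z'E !inE eqxx ?orbT.
move=> z; rewrite mem_filter -[_ :: _]/([:: u; v; w] ++ codom s) mem_cat negb_or.
by case/andP => /andP[zuvw _] _; rewrite pr_predC pr_separating.
Qed.

Lemma pr_poorly_separated (k : nat) :
  prG p (@poorly_separated n k) <=
  n%:R ^+ (k + 3) * (1 - p ^+ 2 * (1 - p)) ^+ (n - k.+3).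
Proof.
have -> : n%:R ^+ (k + 3) =
    #|{: ('I_n * 'I_n * 'I_n) * {ffun 'I_k -> 'I_n}}|%:R :> R.
  rewrite !card_prod card_ffun !card_ord -natrX; congr _%:R.
  by rewrite expnD mulnC !expnS expn0 muln1 mulnA.
apply: pr_exists => // -[[[u v] w] s].
have [uvw|nuvw] := boolP (uniq [:: u; v; w]).
  by apply: le_trans (pr_confined s uvw); apply: pr_mono => // G /andP[].
rewrite /prG big_pred0 => [|G]; last by apply: contraNF nuvw => /andP[].
by apply: exprn_ge0; case/andP: p01 => p0 p1; nra.
Qed.

Lemma pr_has_twins (k : nat) : p <= 1 / 2 ->
  prG p (@has_twins n k) <= n%:R ^+ (2 * k) * (1 - p) ^+ 'C(k, 2).
Proof.
move=> p2; case/andP: (p01) => p0 p1.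
have -> : n%:R ^+ (2 * k) =
    #|{: {ffun 'I_k -> 'I_n} * {ffun 'I_k -> 'I_n}}|%:R :> R.
  by rewrite !card_prod card_ffun !card_ord -natrX mul2n -addnn expnD.
apply: pr_exists => // -[x y] /=.
case: (boolP (disjoint_tuples x y)) => [xy|_]; last first.
  by rewrite /prG big_pred0 //; apply: exprn_ge0; rewrite subr_ge0.
by rewrite pr_twin_tuples // lerXn2r ?nnegrE; nra.
Qed.

End Bounds.

(** * Reconstruction from 1-neighborhoods *)

Section Reconstruction.

Lemma ball1E (T : finType) (G : sgraph T) (v x : T) :
  (x \in Defs.ball G 1 v) = (x == v) || adj G v x.
Proof.
rewrite inE; apply/dist_leP/orP => [[[|y [|z p]]] [//= pp lp _]|].
- by left; rewrite -lp.
- by right; move: pp; rewrite lp andbT.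
case=> [/eqP->|vx]; first by exists [::].
by exists [:: x]; rewrite /= vx.
Qed.

(** The isomorphism of neighborhoods, transported from the subtypes of vertices
    to functions on all vertices; outside of the neighborhoods their values are
    arbitrary. *)
Lemma nbhd1_iso (T : finType) (G H : sgraph T) (v : T) :
    same_nbhds 1 G H ->
  exists f g : T -> T,
    [/\ forall x, adj G v x -> adj H v (f x) /\ g (f x) = x,
        forall y, adj H v y -> adj G v (g y) /\ f (g y) = y &
        forall x y, adj G v x -> adj G v y -> adj H (f x) (f y) = adj G x y].
Proof.
move=> /(_ v)[F [[F' FK F'K] Fv adjF]].
pose f x := val (F (insubd (Defs.center G 1 v) x)).
pose g y := val (F' (insubd (Defs.center H 1 v) y)).
have adjE (K : sgraph T) a b : adj (nbhd K 1 v) a b = adj K (val a) (val b).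
  by rewrite /adj /= ffunE.
have valK (K : sgraph T) x : adj K v x -> val (insubd (Defs.center K 1 v) x) = x.
  by move=> vx; rewrite val_insubd ball1E vx orbT.
have F'v : F' (Defs.center H 1 v) = Defs.center G 1 v by rewrite -Fv FK.
exists f, g; split=> [x vx|y vy|x y vx vy].
- split; last by rewrite /g /f valKd FK valK.
  rewrite /f -[X in adj H X]/(val (Defs.center H 1 v)) -adjE -Fv.
  by rewrite adjF adjE valK.
- split; last by rewrite /g /f valKd F'K valK.
  rewrite /g -[X in adj G X]/(val (Defs.center G 1 v)) -adjE -adjF Fv.
  by rewrite F'K adjE valK.
by rewrite /f -adjE adjF adjE !valK.
Qed.

Variables (n k : nat) (G : sgraph 'I_n).

(** If the separating vertices were fewer than k, a k-tuple listing them, padded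
    with [u], would confine them. *)
Lemma card_separating (u v w : 'I_n) :
    ~~ poorly_separated k G -> uniq [:: u; v; w] ->
  (k <= #|[pred z | separating G u v w z]|)%N.
Proof.
move=> sep uvw; set A := [pred z | _]; rewrite leqNgt; apply: contra sep => Ak.
apply/existsP; exists ((u, v, w), [ffun i : 'I_k => nth u (enum A) i]).
rewrite [uniq _]uvw /=; apply/allP => z; rewrite mem_filter => /andP[zn _].
apply: contra zn => zA; rewrite 3!inE; apply/or4P/Or44.
have {}zA : z \in enum A by rewrite mem_enum.
have zk : (index z (enum A) < k)%N.
  by rewrite (leq_trans _ (ltnW Ak)) // cardE index_mem.
by apply/codomP; exists (Ordinal zk); rewrite ffunE /= nth_index.
Qed.

Lemma reconstructable_of_separated :
  ~~ has_twins k G -> ~~ poorly_separated k G -> exactly_reconstructable 1 G.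
Proof.
move=> twins sep H GH.
have HG v u : adj H v u -> adj G v u.
  move=> vu; have [fv [gv [fvP gvP adjfv]]] := nbhd1_iso v GH.
  have [fu [gu [fuP guP adjfu]]] := nbhd1_iso u GH.
  have [] := gvP u vu; set w := gv u => vw fvw.
  have [<- //|wu] := eqVneq w u.
  have uvw : uniq [:: v; w; u].
    rewrite /= !inE negb_or wu !andbT; apply/andP; split.
      by apply: contraTneq vw => <-; rewrite adj_irrefl.
    by apply: contraTneq vu => <-; rewrite adj_irrefl.
  have := card_separating sep uvw; set A := [pred z | _] => kA.
  pose x := [ffun i : 'I_k => nth v (enum A) i].
  have xA i : separating G v w u (x i).
    have : nth v (enum A) i \in A.
      by rewrite -mem_enum mem_nth // -cardE (leq_trans _ kA).
    by rewrite /x ffunE inE.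
  have xv i : adj G v (x i) by rewrite adj_sym; case/and3P: (xA i).
  have xu i : adj H u (fv (x i)).
    by rewrite adj_sym -fvw adjfv //; case/and3P: (xA i).
  (* The twin tuple lies in the neighborhood of [u], which [x] avoids. *)
  pose y := [ffun i : 'I_k => gu (fv (x i))].
  case/negP: twins; apply/existsP; exists (x, y); rewrite /disjoint_tuples /=.
  have xinj : injective x.
    move=> i j; rewrite !ffunE => /eqP.
    rewrite nth_uniq ?enum_uniq -?cardE ?(leq_trans _ kA) //.
    by move/eqP/val_inj.
  have yK i : fu (y i) = fv (x i) by rewrite [y i]ffunE; case: (guP _ (xu i)).
  have uy i : adj G u (y i) by rewrite [y i]ffunE; case: (guP _ (xu i)).
  apply/andP; split; first apply/and3P; first split.
  - exact/injectiveP.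
  - apply/injectiveP => i j yij; apply: xinj.
    by rewrite -(fvP _ (xv i)).2 -(fvP _ (xv j)).2 -!yK yij.
  - apply/forallP => i; apply/forallP => j.
    by case/and3P: (xA i) => _ _; apply: contraNneq => ->; rewrite adj_sym.
  by apply/allP => e _; rewrite -adjfv // -!yK adjfu.
apply: sgraph_eqP => v u; apply/idP/idP; first exact: HG.
(* Since f_v is injective on the neighbors of [v], the inclusion of the
   neighbors in H among those in G is an equality. *)
have [f [g [fP gP _]]] := nbhd1_iso v GH.
suff /eqP/setP/(_ u) : [set x | adj H v x] == [set x | adj G v x].
  by rewrite !inE => ->.
rewrite finset.eqEcard; apply/andP; split.
  by apply/fintype.subsetP => x; rewrite !inE; apply: HG.
rewrite -(@card_in_imset _ _ f); last first.
  by move=> x y; rewrite !inE => /fP[_ {2}<-] /fP[_ {2}<-] ->.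
apply/subset_leq_card/fintype.subsetP => y /imsetP[x]; rewrite !inE => /fP[vfx _] ->.
exact: vfx.
Qed.

End Reconstruction.

(** * Asymptotic estimates *)

Section Estimates.
Local Open Scope classical_set_scope.
Variable R : realType.

Lemma near_le_powR (e M : R) : 0 < e -> \forall n \near \oo, M <= n%:R `^ e.
Proof.
move=> e0; have [M0|M0] := leP M 0.
  by near=> n; exact: le_trans M0 (powR_ge0 _ _).
have -> : M = (M `^ e^-1) `^ e by rewrite -powRrM mulVf ?lt0r_neq0 // powRr1 // ltW.
near=> n; apply: ge0_ler_powR; rewrite ?nnegrE ?powR_ge0 ?(ltW e0) //.
by near: n; apply: nbhs_infty_ger.
Unshelve. all: by end_near. Qed.

(** With z = n^(e/2), the logarithm is at most (2/e) z, which is linear in z,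
    whereas n^e is z^2. *)
Lemma near_ln_le_powR (e c M : R) : 0 < e -> 0 <= c ->
  \forall n \near \oo, c * ln n%:R + M <= n%:R `^ e.
Proof.
move=> e0 c0; have e2 : 0 < e / 2 by rewrite divr_gt0.
near=> n; have z1 : `|M| + 1 + c / (e / 2) <= n%:R `^ (e / 2).
  by near: n; apply: near_le_powR.
have n0 : 0 < n%:R :> R.
  by apply: (@lt_le_trans _ _ 1) => //; near: n; apply: nbhs_infty_ger.
rewrite [e in leRHS](splitr e) powRD ?(gt_eqF n0) ?implybT //.
have := ln_sublinear (powR_gt0 (e / 2) n0); rewrite ln_powR.
set z := n%:R `^ (e / 2) in z1 *; set L := ln _ => Lz.
have cL : c * L <= c / (e / 2) * z.
  by rewrite -mulrA ler_wpM2l // ler_pdivlMl // ltW.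
have c2 : 0 <= c / (e / 2) by rewrite divr_ge0 // ltW.
have := ler_norm M; have := normr_ge0 M; nra.
Unshelve. all: by end_near. Qed.

Lemma expn_mul_le_expR (x q : R) (a b : nat) : 0 < x -> q <= 1 ->
  x ^+ a * (1 - q) ^+ b <= expR (a%:R * ln x - b%:R * q).
Proof.
move=> x0 q1; rewrite expRD expRM_natl lnK ?posrE // -mulrN expRM_natl.
rewrite ler_wpM2l ?exprn_ge0 ?(ltW x0) //.
by rewrite lerXn2r ?nnegrE ?subr_ge0 ?expR_ge0 ?expR_ge1Dx.
Qed.

Lemma natr_bin2 (k : nat) : 'C(k, 2)%:R = k%:R * (k%:R - 1) / 2 :> R.
Proof.
elim: k => [|k IH]; first by rewrite bin0n !mul0r.
by rewrite binS bin1 natrD IH -natr1; field.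
Qed.

(** Let x = n^(1/3), so that n = x^3 and y = x p is n^(1/3 - alpha), eventually
    larger than any multiple of L = ln n.  For k the integer part of x, the
    exponents in the two bounds are at most 2 k L - p k (k - 1) / 2 and
    (k + 3) L - y^2 x / 4.  Since p (k - 1) is at least y - 2 and k is at most x,
    both are at most - L. *)
Lemma near_union_bounds (alpha : R) : 0 < alpha -> alpha < 1 / 3 ->
  \forall n \near \oo,
    exists2 k : nat, n%:R `^ (- alpha) <= 1 / 2 :> R &
      n%:R ^+ (2 * k) * (1 - n%:R `^ (- alpha)) ^+ 'C(k, 2) <= n%:R^-1 :> R /\
      n%:R ^+ (k + 3) * (1 - (n%:R `^ (- alpha)) ^+ 2 * (1 - n%:R `^ (- alpha)))
         ^+ (n - k.+3) <= n%:R^-1 :> R.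
Proof.
move=> a0 a3; have e0 : 0 < 1 / 3 - alpha by rewrite subr_gt0.
near=> n; have n1 : 1 <= n%:R :> R by near: n; apply: nbhs_infty_ger.
have n0 : 0 < n%:R :> R by apply: lt_le_trans n1.
have L0 : 0 <= ln n%:R :> R by apply: ln_ge0.
have yL : 6 * ln n%:R + 24 <= n%:R `^ (1 / 3 - alpha).
  by near: n; apply: near_ln_le_powR.
have p2 : n%:R `^ (- alpha) <= 1 / 2 :> R.
  rewrite powRN div1r lef_pV2 ?posrE ?powR_gt0 //.
  by near: n; apply: near_le_powR.
have p0 : 0 < n%:R `^ (- alpha) :> R by rewrite powR_gt0.
rewrite powRD ?(gt_eqF n0) ?implybT // in yL.
have x0 : 0 < n%:R `^ (1 / 3) :> R by rewrite powR_gt0.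
have x3 : (n%:R `^ (1 / 3)) ^+ 3 = n%:R :> R.
  by rewrite -powR_mulrn ?ltW // -powRrM divfK // powRr1 ?ltW.
have nE : n%:R^-1 = expR (- ln n%:R) :> R by rewrite expRN lnK ?posrE.
rewrite nE; set p := n%:R `^ (- alpha) in yL p2 p0 *.
set x := n%:R `^ (1 / 3) in yL x0 x3 *; set L := ln n%:R in L0 yL *.
have [] := andP (truncn_itv (ltW x0)); set k := Num.truncn x => kx.
rewrite -natr1 => xk.
have x24 : 24 <= x by nra.
have n2k : k%:R + 3 <= n%:R / 2 :> R by rewrite -x3; nra.
exists k => //; split.
  apply: le_trans (expn_mul_le_expR _ _ _ _) _ => //; first by lra.
  rewrite ler_expR natr_bin2 natrM -/L.
  have pk : 6 * L <= p * (k%:R - 1) by nra.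
  have k1 : 1 <= k%:R :> R by lra.
  have kpk : 0 <= k%:R * (p * (k%:R - 1) - 6 * L).
    by rewrite mulr_ge0 ?ler0n ?subr_ge0.
  have kL : 0 <= (k%:R - 1) * L by rewrite mulr_ge0 ?subr_ge0.
  lra.
apply: le_trans (expn_mul_le_expR _ _ _ _) _ => //; first by nra.
rewrite ler_expR natrD natrB; last first.
  by rewrite -(ler_nat R) -addn3 natrD; lra.
rewrite -addn3 natrD -/L.
have q : p ^+ 2 / 2 <= p ^+ 2 * (1 - p) by nra.
have m : n%:R / 2 <= n%:R - (k%:R + 3) :> R by lra.
have qm : p ^+ 2 / 2 * (n%:R / 2) <= (n%:R - (k%:R + 3)) * (p ^+ 2 * (1 - p)).
  by rewrite [leRHS]mulrC ler_pM //; nra.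
have E : p ^+ 2 / 2 * (n%:R / 2) = (x * p) ^+ 2 * x / 4 by rewrite -x3; field.
have y2 : 8 * L <= (x * p) ^+ 2 by nra.
have : 2 * L * x <= (x * p) ^+ 2 * x / 4 by nra.
nra.
Unshelve. all: by end_near. Qed.

End Estimates.

(** * Exact reconstruction with high probability *)

Local Open Scope classical_set_scope.

Theorem theorem2 (R : realType) (alpha : R)
    (alpha_gt0 : 0 < alpha) (alpha_lt : alpha < 1 / 3) :
  (fun n : nat =>
     gnp_prob (n%:R `^ (- alpha))
       [set G : sgraph 'I_n | exactly_reconstructable 1 G])
    @ \oo --> (1 : R).
Proof.
apply/cvgrPdist_le => e e0; near=> n.
have [|k p2 [twins sep]] := near (near_union_bounds alpha_gt0 alpha_lt) n.
  by [].
have ne : 2 / e <= n%:R by near: n; apply: nbhs_infty_ger.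
set p := n%:R `^ (- alpha) in p2 twins sep *.
have p01 : 0 <= p <= 1 by rewrite powR_ge0 (le_trans p2) //; lra.
set E := [set G | _].
rewrite ger0_norm; last by rewrite subr_ge0; apply: (pr_le1 p01).
rewrite -[gnp_prob p E]/(prG p (fun G => G \in E)) -pr_predC.
pose bad (G : sgraph 'I_n) := has_twins k G || poorly_separated k G.
apply: (@le_trans _ _ (prG p bad)).
  apply: pr_mono => // G; rewrite !unfold_in; apply: contraNT.
  rewrite negb_or => /andP[nt ns]; rewrite inE.
  exact: reconstructable_of_separated nt ns.
apply: le_trans (pr_or p01 _ _) _.
apply: (@le_trans _ _ (n%:R^-1 + n%:R^-1)).
  apply: lerD; first exact: le_trans (pr_has_twins n p01 k p2) twins.
  exact: le_trans (pr_poorly_separated n p01 k) sep.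
have n0 : 0 < n%:R :> R by apply: lt_le_trans ne; rewrite divr_gt0.
rewrite ler_pdivrMr // in ne.
by rewrite -mulr2n -[leLHS]mulr_natl ler_pdivrMr // mulrC.
Unshelve. all: by end_near. Qed.
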